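(* Let $n=2k$ where $k>1$ is an integer. Let $L_{n,\mathbb{Q},n-1}(H)$ be the number of multiplicatively dependent vectors $(\nu_1,\ldots,\nu_n)$ of nonzero rational integers with $|\nu_i|\le H$ for all $i$ and of multiplicative rank $n-1$. Then there exists a positive number $c$ depending on $n$ such that, for all sufficiently large $H$, $$L_{n,\mathbb{Q},n-1}(H)\ge cH^k(\log H)^{(k-1)^2}.$$
   Context: A vector $(\nu_1,\ldots,\nu_n)$ of nonzero complex numbers is multiplicatively dependent if there is a nonzero $(k_1,\ldots,k_n)\in\mathbb{Z}^n$ with $\nu_1^{k_1}\cdots\nu_n^{k_n}=1$. The multiplicative rank $s$ of such a vector: $s=0$ if some coordinate is a root of unity; otherwise $s$ is the largest integer with $1\le s\le n$ such that any $s$ coordinates form a multiplicatively independent vector. (For a nonzero integer $\nu$ the absolute Weil height equals $|\nu|$.) *)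

(* Defs.v *)
From HB Require Import structures.
From mathcomp Require Export all_boot all_order all_algebra.
From mathcomp Require Export finmap complex.
From mathcomp Require Export all_classical all_reals all_analysis.

Set Implicit Arguments.
Unset Strict Implicit.
Unset Printing Implicit Defensive.

Import Order.TTheory GRing.Theory Num.Theory.
Import numFieldNormedType.Exports.

Local Open Scope classical_set_scope.
Local Open Scope ring_scope.

Definition mult_dependent (R : realType) (n : nat) (nu : 'I_n -> R[i]) : Prop :=
  exists k : 'I_n -> int,
    (exists i, k i <> 0) /\ \prod_(i < n) nu i ^ k i = 1.

Definition is_root_of_unity (R : realType) (z : R[i]) : Prop :=
  exists m : nat, (0 < m)%N /\ z ^+ m = 1.

(* A choice of s coordinates is an injection 'I_s -> 'I_n: equal values at
   distinct positions count as distinct coordinates. *)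
Definition any_coords_independent (R : realType) (n : nat) (nu : 'I_n -> R[i])
    (s : nat) : Prop :=
  forall f : 'I_s -> 'I_n, injective f -> ~ mult_dependent (fun j => nu (f j)).

(* When no coordinate is a root of unity and n >= 1, s = 1 qualifies, so the
   maximum below ranges over a nonempty set. *)
Definition mult_rank (R : realType) (n : nat) (nu : 'I_n -> R[i]) : nat :=
  if `[< exists i, is_root_of_unity (nu i) >] then 0%N
  else (\max_(s < n.+1 | (0 < s)%N && `[< any_coords_independent nu s >]) s)%N.

Definition cplx_vec (R : realType) (n : nat) (v : {ffun 'I_n -> int}) :
    'I_n -> R[i] :=
  fun i => (v i)%:~R.

Definition dep_vectors (R : realType) (n r : nat) (H : R) :
    set {ffun 'I_n -> int} :=
  [set v : {ffun 'I_n -> int} | [/\ forall i, v i <> 0,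
               forall i, `|v i|%:~R <= H,
               mult_dependent (cplx_vec R v)
             & mult_rank (cplx_vec R v) = r]].

Lemma finite_dep_vectors (R : realType) (n r : nat) (H : R) :
  finite_set (@dep_vectors R n r H).
Proof.
pose B := (Num.truncn H).+1.
pose g (w : {ffun 'I_n -> bool * 'I_B}) : {ffun 'I_n -> int} :=
  [ffun i => (-1) ^+ (w i).1 * (w i).2%:Z].
apply: (@sub_finite_set _ _ (g @` setT)); last exact/finite_image/finite_finset.
move=> v [_ vH _ _].
have vB i : (absz (v i) < B)%N.
  have aH : (absz (v i))%:R <= H by have := vH i; rewrite -abszE.
  have H0 : 0 <= H by apply: le_trans aH.
  by rewrite ltnS truncn_ge_nat.
exists [ffun i => (v i < 0, Ordinal (vB i))] => //.
by apply/ffunP => i; rewrite !ffunE /= -intEsign.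
Qed.

(* By finite_dep_vectors, fset_set does not take its default value here. *)
Definition num_dep_vectors (R : realType) (n r : nat) (H : R) : nat :=
  #|` fset_set (@dep_vectors R n r H)|%fset.

(* Main.v *)
Require Import Defs.
From mathcomp Require Import zify ring lra.
Import Order.TTheory GRing.Theory Num.Theory.
Import numFieldNormedType.Exports.

Set Implicit Arguments.
Unset Strict Implicit.
Unset Printing Implicit Defensive.

(** Take [k x k] matrices of pairwise coprime integers [a_ij > 1], and let [x_i]
    and [y_j] be the products of the rows and of the columns. Then
    [prod x_i = prod y_j], and comparing exponents at a prime factor of [a_ij]
    shows that any relation [prod x_i^(al_i) * prod y_j^(be_j) = 1] has
    [al_i + be_j = 0] for all [i, j]; so it is determined by any one of its
    exponents, and the [2k] margins have multiplicative rank [2k - 1]. Since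
    [a_ij = gcd(x_i, y_j)], the matrix is recovered from its margins.

    It remains to count matrices. Let [a_ij = 1 + z! b_ij] with [b_ij] in the
    dyadic interval [[2^(e_ij), 2^(e_ij + 1))], where all row and column sums of
    [e] equal [E]; the margins are then [<= C 2^E ~ H]. A common divisor of two
    entries exceeds [z], and a union bound with [sum_(d > z) 1/d^2 <= 1/z] shows
    that at least half of the [2^(k E) ~ H^k] choices of [b] are pairwise
    coprime. The number of exponent matrices [e] is of order
    [E^((k-1)^2) ~ (log H)^((k-1)^2)]. *)

(** * Counting pairwise coprime tuples in dyadic boxes *)

Section CoprimeTuples.

Lemma card_bigcup_leq (I : Type) (T : finType) (r : seq I) (P : pred I)
    (F : I -> {set T}) :
  #|\bigcup_(i <- r | P i) F i| <= \sum_(i <- r | P i) #|F i|.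
Proof.
apply: (big_ind2 (fun (A : {set T}) n => #|A| <= n)) => // [|A m B n Am Bn].
  by rewrite cards0.
by apply: leq_trans (leq_card_setU _ _) _; apply: leq_add.
Qed.

Lemma card_family_prod (aT rT : finType) (F : aT -> pred rT) :
  #|family F| = \prod_t #|F t|.
Proof.
by rewrite card_family foldrE big_map big_enum.
Qed.

(* Such a [d] is coprime to [M], hence the [b] form a single class modulo [d]. *)
Lemma card_dvd_affine (N M B L d : nat) : 0 < d ->
  #|[set b : 'I_N | (B <= b < B + L) && (d %| 1 + M * b)]| <= (L %/ d).+1.
Proof.
move=> d0; set A := [set b | _].
pose f (b : 'I_N) : 'I_(L %/ d).+1 := inord ((b - B) %/ d).
have key (b c : 'I_N) : b \in A -> c \in A -> b <= c -> f b = f c -> b = c.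
  rewrite !inE => /andP[/andP[Bb bL] db] /andP[/andP[Bc cL] dc] bc.
  move=> /(congr1 val) /=; rewrite !inordK ?ltnS ?leq_div2r; try lia.
  move=> E.
  have cdM : coprime d M.
    rewrite /coprime -dvdn1 -(dvdn_addl 1 (_ : _ %| M * b)).
      exact: dvdn_trans (dvdn_gcdl _ _) db.
    by rewrite dvdn_mulr // dvdn_gcdr.
  have dbc : d %| c - b.
    by rewrite -(Gauss_dvdr _ cdM) mulnBr -(subnDl 1) dvdn_sub.
  apply/val_inj => /=.
  have := divn_eq (b - B) d; have := divn_eq (c - B) d; rewrite E.
  have := ltn_pmod (b - B) d0; have := ltn_pmod (c - B) d0.
  case/dvdnP: dbc => [[|r]] ?; [lia | nia].
have fI : {in A &, injective f}.
  move=> b c bA cA fbc; case: (leqP b c) => [|/ltnW] bc; first exact: key.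
  by apply/esym/key.
by rewrite -(card_in_imset fI) (leq_trans (max_card _)) // card_ord.
Qed.

Local Open Scope ring_scope.

Lemma sum_inv_sqr_le (F : realFieldType) (z n : nat) : (0 < z)%N ->
  \sum_(z.+1 <= d < n) (d%:R ^- 2) <= z%:R^-1 :> F.
Proof.
move=> z0; case: (leqP n z.+1) => [nz|zn].
  by rewrite big_geq // invr_ge0.
rewrite -(subnKC (ltnW zn)); move: (_ - _)%N => {zn} j.
(* Telescoping: [1/d^2 <= 1/(d-1) - 1/d]. The subtracted term is kept so that the induction goes
   through. *)
suff: \sum_(z.+1 <= d < z.+1 + j) (d%:R ^- 2) <= z%:R^-1 - (z + j)%:R^-1 :> F.
  by move/le_trans; apply; rewrite lerBlDr lerDl invr_ge0.
elim: j => [|j IH]; first by rewrite !addn0 big_geq // subrr.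
rewrite addnS big_nat_recr /=; last by lia.
apply: le_trans (lerD IH (lexx _)) _.
rewrite -addrA lerD2l addrC lerBlDr addrC addSn addnS -natr1.
set x : F := (z + j)%:R.
have x0 : 0 < x by rewrite ltr0n; lia.
rewrite -subr_ge0.
suff -> : x^-1 - (x + 1)^-1 - (x + 1) ^- 2 = x^-1 * (x + 1) ^- 2.
  by rewrite mulr_ge0 // ?exprVn ?invr_ge0 ?exprn_ge0; lra.
by field; lra.
Qed.

Variables (T : finType) (N z : nat) (e : T -> nat).
Hypothesis z_gt0 : (0 < z)%N.
Hypothesis box_bounded : forall t, (2 ^ (e t).+1 <= N)%N.
Hypothesis z_large : (8 * #|T| ^ 2 <= z)%N.
Hypothesis e_large : forall t, (16 * #|T| ^ 2 * z`! <= 2 ^ e t)%N.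

Let M := z`!.

Definition dyadic_box (t : T) : {set 'I_N} :=
  [set b : 'I_N | 2 ^ e t <= b < 2 ^ e t + 2 ^ e t]%N.

Definition coprime_choices : {set {ffun T -> 'I_N}} :=
  [set b in family dyadic_box |
    [forall s, forall t, (s != t) ==> coprime (1 + M * b s) (1 + M * b t)]].

Lemma card_dyadic_box t : #|dyadic_box t| = (2 ^ e t)%N.
Proof.
have := box_bounded t; rewrite expnS mul2n -addnn => BN.
have bN (i : 'I_(2 ^ e t)) : (2 ^ e t + i < N)%N.
  by apply: leq_trans BN; rewrite ltn_add2l.
have fI : injective (fun i => Ordinal (bN i)).
  by move=> i j /(congr1 val) /= /addnI /val_inj.
rewrite -[RHS]card_ord -(card_codom fI); apply: eq_card => b.
rewrite inE; apply/andP/codomP => [[Bb bB]|[i ->]] /=; last first.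
  by rewrite leq_addr ltn_add2l.
have iB : (b - 2 ^ e t < 2 ^ e t)%N by lia.
by exists (Ordinal iB); apply/val_inj; rewrite /= subnKC.
Qed.

Definition common_divisor_choices (s t : T) (d : nat) : {set {ffun T -> 'I_N}} :=
  [set b in family dyadic_box | (d %| 1 + M * b s)%N && (d %| 1 + M * b t)%N].

Let B (t : T) : rat := (2 ^ e t)%:R.
Let B_gt0 t : 0 < B t.
Proof. by rewrite ltr0n expn_gt0. Qed.

(** Only the coordinates [s] and [t] are constrained. By [card_dvd_affine], each of them keeps at
    most [B/d + 1] of its [B] values, a proportion [1/d + 1/B]. *)
Lemma card_common_divisor_choices s t d : s != t -> (0 < d)%N ->
  #|common_divisor_choices s t d|%:R <=
    (\prod_r B r) * ((d%:R^-1 + (B s)^-1) * (d%:R^-1 + (B t)^-1)).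
Proof.
move=> st d0.
pose A r := [set b : 'I_N | b \in dyadic_box r & (d %| 1 + M * b)%N].
pose F r := if (r == s) || (r == t) then A r else dyadic_box r.
have le1 : (#|common_divisor_choices s t d| <= \prod_r #|F r|)%N.
  rewrite -(card_family_prod (fun r => mem (F r))).
  apply/subset_leq_card/fintype.subsetP => b.
  rewrite inE => /andP[/familyP bbox /andP[ds dt]].
  apply/familyP => r; rewrite /F; case: ifP => [|_]; last exact: bbox.
  by case/orP=> /eqP ->; rewrite !inE ?ds ?dt andbT;
    have := bbox s; have := bbox t; rewrite !inE.
have FB r : #|F r|%:R <= B r * (if (r == s) || (r == t) then d%:R^-1 + (B r)^-1 else 1) :> rat.
  rewrite /F; case: ifP => _; last by rewrite mulr1 card_dyadic_box.
  rewrite mulrDr divff ?gt_eqF //.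
  have -> : A r = [set b : 'I_N | (2 ^ e r <= b < 2 ^ e r + 2 ^ e r)%N && (d %| 1 + M * b)%N].
    by apply/setP => b; rewrite !inE.
  apply: (@le_trans _ _ ((2 ^ e r %/ d).+1)%:R).
    by rewrite ler_nat card_dvd_affine.
  rewrite -natr1 lerD2r ler_pdivlMr ?ltr0n // -natrM ler_nat.
  exact: leq_trunc_div.
apply: (@le_trans _ _ (\prod_r #|F r|)%:R); first by rewrite ler_nat.
rewrite natr_prod; apply: (@le_trans _ _ (\prod_r (B r *
   (if (r == s) || (r == t) then d%:R^-1 + (B r)^-1 else 1)))).
  by apply: ler_prod => r _; rewrite ler0n FB.
rewrite big_split /= ler_wpM2l //.
  by apply: prodr_ge0 => r _; apply: ltW.
rewrite (bigD1 s) //= (bigD1 t) /=; last by rewrite eq_sym.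
rewrite !eqxx orbT big1 ?mulr1 //.
by move=> r /andP[/negPf -> /negPf ->].
Qed.

(* A common divisor [d > 1] of two numbers [1 + z! b] exceeds [z]. *)
Lemma family_dyadic_box_sub :
  [set b in family dyadic_box] \subset coprime_choices :|:
   \bigcup_(st : T * T | (st.1 != st.2) && (e st.1 <= e st.2)%N)
    \bigcup_(z.+1 <= d < (2 * M * 2 ^ e st.1).+1)
      common_divisor_choices st.1 st.2 d.
Proof.
apply/fintype.subsetP => b; rewrite inE => bF.
rewrite finset.in_setU; case: (boolP (b \in coprime_choices)) => //=.
rewrite inE bF /= negb_forall => /existsP[s0].
rewrite negb_forall => /existsP[t0]; rewrite negb_imply => /andP[].
wlog est : s0 t0 / (e s0 <= e t0)%N => [W st nc|].
  case: (leqP (e s0) (e t0)) => [|/ltnW] est; first exact: (W s0 t0).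
  by apply: (W t0 s0); rewrite // 1?eq_sym // coprime_sym.
move=> st nc.
apply/bigcupP; exists (s0, t0); first by rewrite /= st est.
rewrite /=; set d := gcdn (1 + M * b s0) (1 + M * b t0).
have d0 : (0 < d)%N by rewrite gcdn_gt0.
have ds : (d %| 1 + M * b s0)%N by apply: dvdn_gcdl.
have dz : (z < d)%N.
  rewrite ltnNge; apply: contra nc => dz.
  rewrite /coprime -dvdn1 -(dvdn_addl 1 (_ : (_ %| M * b s0)%N)) //.
  by rewrite dvdn_mulr // dvdn_fact // d0.
have dle : (d < (2 * M * 2 ^ e s0).+1)%N.
  have M0 : (0 < M)%N by apply: fact_gt0.
  rewrite ltnS; apply: leq_trans (dvdn_leq _ ds) _ => //.
  have /familyP /(_ s0) := bF; rewrite inE => /andP[_ bs].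
  apply: (@leq_trans (M * (b s0).+1)); first by rewrite mulnS leq_add2r.
  by rewrite mulnAC mul2n -addnn mulnC leq_mul2r bs orbT.
have := mem_index_iota z.+1 (2 * M * 2 ^ e s0).+1 d; rewrite dz dle => dm.
rewrite (big_rem d) //= finset.in_setU.
by apply/orP; left; rewrite inE bF ds dvdn_gcdr.
Qed.

(** Union bound over at most [m^2] pairs, where [m = #|T|]: each pair spoils at most a proportion
    [1/(2 m^2)] of the box, so that at least half of it survives. This proportion is the sum of two
    contributions of at most [1/(4 m^2)], one controlled by [z_large] and the other by [e_large]. *)
Lemma coprime_choices_lower_bound :
  (\prod_t 2 ^ e t <= 2 * #|coprime_choices|)%N.
Proof.
have M0 : (0 < M)%N by apply: fact_gt0.
have := subset_leq_card family_dyadic_box_sub.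
rewrite cardsE (card_family_prod (fun r => mem (dyadic_box r))).
under eq_bigr do rewrite card_dyadic_box.
move=> /leq_trans /(_ (leq_card_setU _ _)).
move=> /leq_trans /(_ (leq_add (leqnn _) (card_bigcup_leq _ _ _))) le1.
set P := (\prod_t _)%N in le1 *.
have {}le1 : (P <= #|coprime_choices| +
    \sum_(st : T * T | (st.1 != st.2) && (e st.1 <= e st.2))
      \sum_(z.+1 <= d < (2 * M * 2 ^ e st.1).+1)
        #|common_divisor_choices st.1 st.2 d|)%N.
  apply: leq_trans le1 _; rewrite leq_add2l.
  by apply: leq_sum => st _; apply: card_bigcup_leq.
have PE : P%:R = \prod_r B r by rewrite natr_prod.
set S := (\sum_(_ | _) _)%N in le1.
suff le2 : S%:R <= P%:R / 2 :> rat.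
  by move: le1; rewrite -!(ler_nat rat) natrD natrM; lra.
have [T0|T0] := posnP #|T|.
  rewrite /S big1 ?mulr_ge0 ?invr_ge0 //.
  by move=> [s t] _; have := fintype0 s.
have zm := z_large; have em := e_large; set m := #|T| in T0 zm em.
have step (st : T * T) : (st.1 != st.2) && (e st.1 <= e st.2)%N ->
   (\sum_(z.+1 <= d < (2 * M * 2 ^ e st.1).+1)
      #|common_divisor_choices st.1 st.2 d|)%:R <= P%:R / (2 * m%:R ^+ 2) :> rat.
  case: st => s t /= /andP[st est].
  rewrite natr_sum.
  have X0 := B_gt0 s; set x := B s in X0.
  (* As [e s <= e t], the factor [(1/d + 1/x) (1/d + 1/B t)] is at most
     [(1/d + 1/x)^2 <= 2/d^2 + 2/x^2]. The first terms sum to at most [2/z]. There are at most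
     [2 M x] values of [d], so the second terms sum to at most [4 M / x]. *)
  apply: (@le_trans _ _ (\sum_(z.+1 <= d < (2 * M * 2 ^ e s).+1)
      (P%:R * (2 * d%:R ^- 2 + 2 * x ^- 2)))).
    apply: ler_sum_nat => d /andP[zd _].
    apply: le_trans (card_common_divisor_choices st _) _; first by lia.
    rewrite -PE ler_wpM2l //.
    have Y : 0 <= (B t)^-1 <= x^-1.
      rewrite invr_ge0 ltW // lef_pV2 ?posrE // /x /B ler_nat.
      by rewrite leq_exp2l.
    have D0 : 0 <= d%:R^-1 :> rat by rewrite invr_ge0.
    rewrite -!exprVn; move: (B t)^-1 x^-1 d%:R^-1 Y D0 => Y X D Y0 D0.
    apply: (@le_trans _ _ ((D + X) * (D + X))); first by rewrite ler_wpM2l; lra.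
    by have := sqr_ge0 (D - X); lra.
  rewrite -mulr_sumr ler_wpM2l // big_split /= -mulr_sumr sumr_const_nat.
  have le3 := sum_inv_sqr_le rat (2 * M * 2 ^ e s).+1 z_gt0.
  have m0 : 0 < m%:R :> rat by rewrite ltr0n.
  have le4 : z%:R^-1 <= (8 * m%:R ^+ 2)^-1 :> rat.
    rewrite lef_pV2 ?posrE ?ltr0n // ?mulr_gt0 ?exprn_gt0 //.
    by rewrite -natrX -natrM ler_nat.
  have le5 : (2 * x ^- 2) *+ ((2 * M * 2 ^ e s).+1 - z.+1) <= 4 * M%:R / x.
    rewrite subSS -mulr_natr.
    apply: (@le_trans _ _ ((2 * x ^- 2) * (2 * M * 2 ^ e s)%:R)).
      rewrite ler_wpM2l ?ler_nat ?leq_subr // mulr_ge0 //.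
      by rewrite invr_ge0 exprn_ge0 // ltW.
    rewrite !natrM -/(B s) -/x.
    by rewrite le_eqVlt; apply/orP; left; apply/eqP; field; rewrite gt_eqF.
  have le6 : 4 * M%:R / x <= (4 * m%:R ^+ 2)^-1.
    have := em s; rewrite -(ler_nat rat) -/(B s) -/x -/M !natrM => le6.
    rewrite ler_pdivrMr // -(ler_pM2l (_ : 0 < 4 * m%:R ^+ 2)) ?mulr_gt0 ?exprn_gt0 //.
    rewrite mulVKf ?gt_eqF ?mulr_gt0 ?exprn_gt0 //.
    by apply: le_trans le6; rewrite le_eqVlt; apply/orP; left; apply/eqP; ring.
  have m2E (c : rat) : (c * m%:R ^+ 2)^-1 = c^-1 * (m%:R ^+ 2)^-1 by rewrite invfM.
  rewrite m2E in le4; rewrite m2E in le6; rewrite m2E.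
  by move: (\sum_(_ <= _ < _) _) (_ *+ _) le3 le4 le5 le6 => S' Y'; lra.
rewrite /S natr_sum; apply: le_trans (ler_sum _ step) _.
rewrite sumr_const -[X in X <= _]mulr_natr.
have m0 : 0 < m%:R :> rat by rewrite ltr0n.
apply: (@le_trans _ _ (P%:R / (2 * m%:R ^+ 2) * m%:R ^+ 2)).
  rewrite ler_wpM2l //.
  by rewrite -natrX ler_nat (leq_trans (max_card _)) // card_prod.
by rewrite le_eqVlt; apply/orP; left; apply/eqP; field; rewrite gt_eqF.
Qed.

End CoprimeTuples.

(** * Multiplicative relations between the margins of a coprime matrix *)

Section Margins.

Lemma coprime_prodr (I : Type) (r : seq I) (P : pred I) (F : I -> nat) (m : nat) :
  (forall i, P i -> coprime m (F i)) -> coprime m (\prod_(i <- r | P i) F i).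
Proof.
move=> cF; apply: (big_ind (fun x => coprime m x)) => // [|x y cx cy]; first exact: coprimen1.
by rewrite coprimeMr cx.
Qed.

Local Open Scope ring_scope.

Lemma expfz_prod (F : fieldType) (I : Type) (r : seq I) (P : pred I)
    (f : I -> F) (z : int) :
  (\prod_(i <- r | P i) f i) ^ z = \prod_(i <- r | P i) f i ^ z.
Proof.
by apply: (big_morph (fun x : F => x ^ z)) => [x y|]; rewrite ?expfzMl ?exp1rz.
Qed.

Lemma expfz_sum (F : fieldType) (I : Type) (r : seq I) (P : pred I)
    (x : F) (f : I -> int) : x != 0 ->
  x ^ (\sum_(i <- r | P i) f i) = \prod_(i <- r | P i) x ^ f i.
Proof.
by move=> x0; apply: (big_morph (fun z => x ^ z)) => // y z; rewrite expfzDr.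
Qed.

(** Moving the nonpositive exponents to the other side turns the relation into an equality [P = Q]
    of natural numbers. A base with positive exponent would divide [P] and be coprime to [Q],
    although it exceeds 1. Hence no exponent is positive, and the inverse relation shows that none
    is negative. *)
Lemma pairwise_coprime_indep (F : numFieldType) (T : finType) (a : T -> nat)
    (g : T -> int) :
  (forall t, (1 < a t)%N) -> (forall s t, s != t -> coprime (a s) (a t)) ->
  \prod_t (a t)%:R ^ g t = 1 :> F -> forall t, g t = 0.
Proof.
move=> a_gt1 a_coprime.
suff le0 (h : T -> int) : \prod_t (a t)%:R ^ h t = 1 :> F -> forall t, h t <= 0.
  move=> g1 t; apply/eqP; rewrite eq_le le0 //= -oppr_le0.
  apply: (le0 (fun t => - g t)); under eq_bigr do rewrite -invr_expz.
  by rewrite prodfV g1 invr1.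
move=> h1 t0; rewrite leNgt; apply/negP => ht0.
pose P := (\prod_(t | (0 < h t)%R) a t ^ `|h t|)%N.
pose Q := (\prod_(t | ~~ (0 < h t)%R) a t ^ `|h t|)%N.
have aR t : (a t)%:R != 0 :> F by rewrite pnatr_eq0; have := a_gt1 t; lia.
have PE : \prod_(t | 0 < h t) (a t)%:R ^ h t = P%:R :> F.
  rewrite natr_prod; apply: eq_bigr => t ht.
  by rewrite natrX exprnP; congr (_ ^ _); lia.
have QE : \prod_(t | ~~ (0 < h t)) (a t)%:R ^ h t = Q%:R^-1 :> F.
  rewrite natr_prod -prodfV; apply: eq_bigr => t ht.
  by rewrite natrX exprnP invr_expz; congr (_ ^ _); lia.
have PQ : P = Q.
  have Q0 : Q%:R != 0 :> F.
    by rewrite natr_prod; apply/prodf_neq0 => t _; rewrite natrX expf_neq0.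
  apply/eqP; rewrite -(eqr_nat F); apply/eqP.
  move: h1; rewrite (bigID (fun t => 0 < h t)) /= PE QE.
  by move=> /(canRL (mulfVK Q0)) ->; rewrite mul1r.
have cQ : coprime (a t0) Q.
  apply: coprime_prodr => t ht; apply: coprimeXr; apply: a_coprime.
  by apply: contraNneq ht => <-.
have dQ : (a t0 %| Q)%N.
  by rewrite -PQ /P (bigD1 t0) //= dvdn_mulr // dvdn_exp // absz_gt0 gt_eqF.
move: cQ; rewrite /coprime (gcdn_idPl dQ) => /eqP a1.
by have := a_gt1 t0; rewrite a1.
Qed.

Variables (R : realType) (k : nat) (a : 'I_k * 'I_k -> nat).
Hypothesis k_gt0 : (0 < k)%N.
Hypothesis a_gt1 : forall t, (1 < a t)%N.
Hypothesis a_coprime : forall s t, s != t -> coprime (a s) (a t).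

Definition row_prod (b : 'I_k * 'I_k -> nat) i : nat := \prod_j b (i, j).
Definition col_prod (b : 'I_k * 'I_k -> nat) j : nat := \prod_i b (i, j).

Definition margins (b : 'I_k * 'I_k -> nat) : {ffun 'I_(k + k) -> int} :=
  [ffun l => match fintype.split l with
             | inl i => (row_prod b i)%:Z
             | inr j => (col_prod b j)%:Z
             end].

Lemma margins_lshift b i : margins b (lshift k i) = (row_prod b i)%:Z.
Proof. by rewrite ffunE (unsplitK (inl i)). Qed.

Lemma margins_rshift b j : margins b (rshift k j) = (col_prod b j)%:Z.
Proof. by rewrite ffunE (unsplitK (inr j)). Qed.

(** Row [i] and column [j] share exactly the entry [a (i, j)], and the two cofactors are coprime.
    This is how the matrix is read off from its margins. *)
Lemma gcdn_margins i j : gcdn (row_prod a i) (col_prod a j) = a (i, j).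
Proof.
rewrite /row_prod /col_prod [X in gcdn X](bigD1 j) //= [X in gcdn _ X](bigD1 i) //=.
rewrite -muln_gcdr.
rewrite (eqP (_ : coprime _ _)) ?muln1 //.
apply: coprime_prodr => i' ii'; rewrite coprime_sym; apply: coprime_prodr => j' jj'.
by apply: a_coprime; rewrite xpair_eqE negb_and ii'.
Qed.

Lemma margins_gt1 l : (1 < margins a l)%R.
Proof.
have prod_gt1 (f : 'I_k -> nat) : (forall i, 1 < f i)%N -> (1 < \prod_i f i)%N.
  move=> f1; rewrite (bigD1 (Ordinal k_gt0)) //=.
  apply: leq_trans (f1 (Ordinal k_gt0)) (leq_pmulr _ _).
  by apply: prodn_cond_gt0 => i _; apply: ltnW.
rewrite -(splitK l); case: (fintype.split l) => i /=.
  by rewrite margins_lshift ltz_nat; apply: prod_gt1.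
by rewrite margins_rshift ltz_nat; apply: prod_gt1.
Qed.

Lemma cplx_margins_neq0 l : cplx_vec R (margins a) l != 0.
Proof. by rewrite intr_eq0 gt_eqF // (lt_trans _ (margins_gt1 l)). Qed.

(** Each entry divides one row product and one column product, and collects the exponents of
    both. *)
Lemma prod_margins (al : 'I_(k + k) -> int) :
  \prod_l cplx_vec R (margins a) l ^ al l =
  \prod_t (a t)%:R ^ (al (lshift k t.1) + al (rshift k t.2)).
Proof.
have aR t : (a t)%:R != 0 :> R[i] by rewrite pnatr_eq0; have := a_gt1 t; lia.
under [RHS]eq_bigr do rewrite expfzDr //.
rewrite big_split_ord big_split /=; congr (_ * _).
  transitivity (\prod_i \prod_j (a (i, j))%:R ^ al (lshift k i) : R[i]).
    apply: eq_bigr => i _.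
    by rewrite /cplx_vec margins_lshift -pmulrn natr_prod expfz_prod.
  by rewrite pair_bigA; apply: eq_bigr => -[].
transitivity (\prod_j \prod_i (a (i, j))%:R ^ al (rshift k j) : R[i]).
  apply: eq_bigr => j _.
  by rewrite /cplx_vec margins_rshift -pmulrn natr_prod expfz_prod.
by rewrite exchange_big pair_bigA; apply: eq_bigr => -[].
Qed.

Lemma margins_dependent : mult_dependent (cplx_vec R (margins a)).
Proof.
exists (fun l => if fintype.split l is inl _ then 1 else -1); split.
  by exists (lshift k (Ordinal k_gt0)); rewrite (unsplitK (inl _)).
rewrite prod_margins big1 // => t _.
by rewrite (unsplitK (inl _)) (unsplitK (inr _)) subrr.
Qed.

Lemma margins_relation (al : 'I_(k + k) -> int) :
  \prod_l cplx_vec R (margins a) l ^ al l = 1 ->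
  forall i j, al (lshift k i) + al (rshift k j) = 0.
Proof.
rewrite prod_margins => /(pairwise_coprime_indep a_gt1 a_coprime) al0 i j.
exact: al0 (i, j).
Qed.

Lemma margins_proper_coords_independent :
  any_coords_independent (cplx_vec R (margins a)) (k + k - 1).
Proof.
move=> f fI [c [[j0 cj0] c1]].
(* Extension of the relation [c] by zero to all [k + k] margins. It vanishes at any index that [f]
   misses, and [f] misses one by cardinality. *)
pose al l := \sum_(j | f j == l) c j.
have al1 : \prod_l cplx_vec R (margins a) l ^ al l = 1.
  rewrite -[RHS]c1 (partition_big f predT) //=; apply: eq_bigr => l _.
  rewrite expfz_sum ?cplx_margins_neq0 //.
  by apply: eq_bigr => j /eqP ->.
have alf j : al (f j) = c j.
  rewrite /al (eq_bigl (pred1 j)) ?big_pred1_eq // => i /=.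
  exact: (inj_eq fI).
have [l0 l0f] : exists l0, l0 \notin codom f.
  apply/existsP; rewrite -negb_forall; apply/negP => /forallP fs.
  have : (#|'I_(k + k)| <= #|codom f|)%N.
    by apply/subset_leq_card/fintype.subsetP => l _; apply: fs.
  rewrite card_codom // !card_ord; lia.
have al0 : al l0 = 0.
  rewrite /al big_pred0 // => j; apply/negP => /eqP fj.
  by rewrite -fj codom_f in l0f.
have alE := margins_relation al1.
(* The zero at [l0] passes to every margin on the opposite side, and from there back to the side of
   [l0]; [Ordinal k_gt0] serves as the intermediate index. *)
have alall l : al l = 0.
  move: al0; rewrite -(splitK l0) -(splitK l).
  case: (fintype.split l0) => i0; case: (fintype.split l) => i /= al0.
  - by have := alE i (Ordinal k_gt0); have := alE i0 (Ordinal k_gt0); rewrite al0; lia.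
  - by have := alE i0 i; rewrite al0 add0r.
  - by have := alE i i0; rewrite al0 addr0.
  - by have := alE (Ordinal k_gt0) i; have := alE (Ordinal k_gt0) i0; rewrite al0; lia.
by apply: cj0; rewrite -alf.
Qed.

Lemma margins_not_root_of_unity l : ~ is_root_of_unity (cplx_vec R (margins a) l).
Proof.
move=> [m [m0 /eqP]]; rewrite /cplx_vec -rmorphXn /= (eqr_int _ _ 1).
by rewrite gt_eqF // exprn_egt1 ?margins_gt1 // -lt0n.
Qed.

Lemma mult_rank_margins : mult_rank (cplx_vec R (margins a)) = (k + k - 1)%N.
Proof.
rewrite /mult_rank asboolF; last by move=> [l]; apply: margins_not_root_of_unity.
apply/eqP; rewrite eqn_leq; apply/andP; split.
  apply/bigmax_leqP => s /andP[_ /asboolP s_indep].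
  have := ltn_ord s; rewrite ltnS leq_eqVlt => /orP[/eqP sE|]; last by lia.
  (* For [s = k + k] the identity selects all the coordinates, and these are dependent. *)
  exfalso; move: s_indep; rewrite sE => /(_ id) []; first exact: inj_id.
  exact: margins_dependent.
have lt : (k + k - 1 < (k + k).+1)%N by lia.
apply: (@leq_bigmax_cond _ _ (fun s : 'I_(k + k).+1 => nat_of_ord s) (Ordinal lt)).
rewrite /= subn_gt0 (leq_ltn_trans k_gt0) ?asboolT //; last by lia.
exact: margins_proper_coords_independent.
Qed.

Lemma margins_dep_vectors (H : R) :
  (forall i, (row_prod a i)%:R <= H) -> (forall j, (col_prod a j)%:R <= H) ->
  dep_vectors (k + k - 1) H (margins a).
Proof.
move=> rowH colH; split; [| | exact: margins_dependent | exact: mult_rank_margins].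
  by move=> l; have := margins_gt1 l; lia.
move=> l; rewrite -(splitK l); case: (fintype.split l) => i /=.
  by rewrite margins_lshift /=; apply: rowH.
by rewrite margins_rshift /=; apply: colH.
Qed.

End Margins.

(** * Exponent matrices with constant row and column sums *)

Section ExponentMatrices.

Variables (p w q : nat).
Implicit Types u : {ffun 'I_p * 'I_p -> 'I_w}.

Definition total u : nat := \sum_i \sum_j u (i, j).

(* The perturbation [u] of the constant matrix [q] on the complement of the
   first row and column, completed so that every row and column sum is
   [p.+1 * q]. *)
Definition expo_matrix u (t : 'I_p.+1 * 'I_p.+1) : nat :=
  match unlift ord0 t.1, unlift ord0 t.2 with
  | Some i, Some j => q - u (i, j)
  | Some i, None => q + \sum_j u (i, j)
  | None, Some j => q + \sum_i u (i, j)
  | None, None => q - total u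
  end.

Hypothesis q_large : 2 * p.+1 ^ 2 * w <= q.

(** Ensures that the truncated subtraction in the corner [q - total u] is exact, and leaves at least
    [w] there. *)
Lemma total_le u : total u + w <= q.
Proof.
have le1 : total u <= \sum_(i < p) \sum_(j < p) w.
  by apply: leq_sum => i _; apply: leq_sum => j _; apply: ltnW.
rewrite !sum_nat_const !card_ord in le1; nia.
Qed.

Lemma entry_le u t : u t + w <= q.
Proof. by have := ltn_ord (u t); nia. Qed.

(** Large exponents are what the hypothesis [e_large] of the coprimality count asks for. *)
Lemma expo_matrix_ge u t : w <= expo_matrix u t.
Proof.
have wq : w <= q by nia.
rewrite /expo_matrix; case: unliftP => [i _|_]; case: unliftP => [j _|_].
- by have := entry_le u (i, j); lia.
- by rewrite (leq_trans wq) ?leq_addr.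
- by rewrite (leq_trans wq) ?leq_addr.
- by have := total_le u; lia.
Qed.

Lemma sum_complement (f : 'I_p -> nat) : (forall i, f i <= q) ->
  \sum_i f i + \sum_i (q - f i) = p * q.
Proof.
move=> fq; rewrite -big_split /= (eq_bigr (fun=> q)) => [|i _]; last by rewrite subnKC.
by rewrite sum_nat_const card_ord.
Qed.

Lemma expo_matrix_row u i : \sum_j expo_matrix u (i, j) = p.+1 * q.
Proof.
rewrite big_ord_recl /expo_matrix /= unlift_none.
case: unliftP => [i' _|_]; under [X in _ + X = _]eq_bigr do rewrite liftK.
  by rewrite -addnA sum_complement ?mulSn // => j;
    apply: leq_trans (leq_addr _ _) (entry_le u (i', j)).
rewrite big_split /= sum_nat_const card_ord [X in _ + (_ + X)]exchange_big /= -/(total u).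
by have := total_le u; rewrite mulSn; lia.
Qed.

Lemma expo_matrix_col u j : \sum_i expo_matrix u (i, j) = p.+1 * q.
Proof.
rewrite big_ord_recl /expo_matrix /= unlift_none.
case: unliftP => [j' _|_]; under [X in _ + X = _]eq_bigr do rewrite liftK.
  by rewrite -addnA sum_complement ?mulSn // => i;
    apply: leq_trans (leq_addr _ _) (entry_le u (i, j')).
rewrite big_split /= sum_nat_const card_ord -/(total u).
by have := total_le u; rewrite mulSn; lia.
Qed.

Lemma expo_matrix_inj u v : expo_matrix u =1 expo_matrix v -> u = v.
Proof.
move=> uv; apply/ffunP => -[i j]; apply/val_inj => /=.
have := uv (lift ord0 i, lift ord0 j); rewrite /expo_matrix !liftK /=.
have le_q (u' : {ffun 'I_p * 'I_p -> 'I_w}) : u' (i, j) <= q :=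
  leq_trans (leq_addr _ _) (entry_le u' (i, j)).
by move=> /(congr1 (subn q)); rewrite !subKn.
Qed.

End ExponentMatrices.

(** * From choices of exponents and entries to dependent vectors *)

Section Construction.

Variables (R : realType) (p w z : nat).
Let k := p.+1.
Let q := 2 * k ^ 2 * w.
Let N := 2 ^ (k * q).+1.
Let T := ('I_k * 'I_k)%type.
Hypothesis z_large : 8 * (k * k) ^ 2 <= z.
Hypothesis w_large : 16 * (k * k) ^ 2 * z`! <= w.

Definition entries (b : {ffun 'I_k * 'I_k -> 'I_N}) (t : 'I_k * 'I_k) : nat :=
  1 + z`! * b t.

Definition choices : {set {ffun 'I_p * 'I_p -> 'I_w} * {ffun 'I_k * 'I_k -> 'I_N}} :=
  [set ub | ub.2 \in coprime_choices N z (expo_matrix q ub.1)].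

(** The size of the box depends only on the sum of all exponents, which is [k * (k * q)] for every
    [u]. The same lower bound thus holds for each of the [w ^ (p ^ 2)] perturbations, and this
    factor becomes the power of the logarithm. *)
Lemma card_choices : w ^ (p ^ 2) * 2 ^ (k * (k * q)) <= 2 * #|choices|.
Proof.
have -> : #|choices| =
    \sum_(u : {ffun 'I_p * 'I_p -> 'I_w}) #|coprime_choices N z (expo_matrix q u)|.
  under eq_bigr do rewrite -sum1_card.
  rewrite pair_big_dep /= -sum1_card; apply: eq_bigl => -[u b].
  by rewrite inE.
rewrite big_distrr /=.
have -> : w ^ (p ^ 2) = #|{ffun 'I_p * 'I_p -> 'I_w}|.
  by rewrite card_ffun card_prod !card_ord.
rewrite -sum_nat_const; apply: leq_sum => u _.
have -> : 2 ^ (k * (k * q)) = \prod_(t : T) 2 ^ expo_matrix q u t.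
  rewrite -expn_sum; congr (2 ^ _).
  rewrite -(pair_bigA _ (fun i j => expo_matrix q u (i, j))) /=.
  under eq_bigr do rewrite expo_matrix_row //.
  by rewrite sum_nat_const card_ord.
apply: coprime_choices_lower_bound; rewrite ?card_prod ?card_ord //.
- by apply: leq_trans z_large; rewrite muln_gt0 expn_gt0.
(* An exponent is at most its row sum [k * q]; hence the choice of [N]. *)
- move=> t; rewrite leq_exp2l // ltnS -(expo_matrix_row (leqnn _) u t.1).
  by rewrite (bigD1 t.2) //= -surjective_pairing leq_addr.
- move=> t; apply: leq_trans w_large _.
  apply: leq_trans (ltnW (ltn_expl w (isT : 1 < 2))) _.
  by rewrite leq_exp2l // expo_matrix_ge.
Qed.

Lemma choices_box u b t : (u, b) \in choices ->
  2 ^ expo_matrix q u t <= b t < 2 ^ (expo_matrix q u t).+1.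
Proof.
rewrite inE /= inE => /andP[/familyP /(_ t)].
by rewrite inE expnS mul2n -addnn.
Qed.

Lemma choices_coprime u b s t : (u, b) \in choices -> s != t ->
  coprime (entries b s) (entries b t).
Proof.
by rewrite inE /= inE => /andP[_ /forallP /(_ s) /forallP /(_ t) /implyP].
Qed.

Lemma entries_gt1 u b t : (u, b) \in choices -> 1 < entries b t.
Proof.
move=> /(choices_box t) /andP[bt _]; rewrite /entries -[X in X < _]addn0 ltn_add2l.
by rewrite muln_gt0 fact_gt0 (leq_trans _ bt) ?expn_gt0.
Qed.

Lemma entries_le u b t : (u, b) \in choices ->
  entries b t <= 2 * z`! * 2 ^ expo_matrix q u t.
Proof.
move=> /(choices_box t) /andP[_ bt]; rewrite /entries.
apply: (@leq_trans (z`! * (b t).+1)); first by rewrite mulnS leq_add2r fact_gt0.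
by rewrite -mulnA mulnCA leq_mul2l -expnS bt orbT.
Qed.

Lemma row_prod_le u b i : (u, b) \in choices ->
  row_prod (entries b) i <= (2 * z`!) ^ k * 2 ^ (k * q).
Proof.
move=> ub; apply: leq_trans (leq_prod (fun j _ => entries_le (i, j) ub)) _.
by rewrite big_split /= prod_nat_const card_ord -expn_sum expo_matrix_row.
Qed.

Lemma col_prod_le u b j : (u, b) \in choices ->
  col_prod (entries b) j <= (2 * z`!) ^ k * 2 ^ (k * q).
Proof.
move=> ub; apply: leq_trans (leq_prod (fun i _ => entries_le (i, j) ub)) _.
by rewrite big_split /= prod_nat_const card_ord -expn_sum expo_matrix_col.
Qed.

(** The gcds of the margins give the entries, hence [b]. Each [b t] lies in only one dyadic
    interval, so its binary logarithm gives the exponent at [t], and the exponents determine [u]. *)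
Lemma margins_entries_inj :
  {in choices &, injective (fun ub => margins (entries ub.2))}.
Proof.
move=> [u b] [v c] ub vc /= /ffunP E.
have rowE i : row_prod (entries b) i = row_prod (entries c) i.
  by have := E (lshift k i); rewrite !margins_lshift => -[].
have colE j : col_prod (entries b) j = col_prod (entries c) j.
  by have := E (rshift k j); rewrite !margins_rshift => -[].
have bc : b = c.
  apply/ffunP => -[i j]; apply/val_inj => /=.
  have := gcdn_margins (fun s t => choices_coprime ub) i j.
  rewrite rowE colE (gcdn_margins (fun s t => choices_coprime vc)) /entries => /addnI/eqP.
  by rewrite eqn_pmul2l ?fact_gt0 // => /eqP.
rewrite -bc in vc *; congr (_, _); apply: (expo_matrix_inj (leqnn q)) => t.
by rewrite -(trunc_log_eq _ (choices_box t ub)) // (trunc_log_eq _ (choices_box t vc)).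
Qed.

Lemma num_dep_vectors_ge (H : R) :
  (((2 * z`!) ^ k * 2 ^ (k * q))%:R <= H)%R ->
  w ^ (p ^ 2) * 2 ^ (k * (k * q)) <= 2 * num_dep_vectors (k + k) (k + k - 1) H.
Proof.
move=> AH; apply: leq_trans card_choices _; rewrite leq_mul2l /= cardE.
rewrite -(size_map (fun ub => margins (entries ub.2))).
apply: uniq_leq_size.
  rewrite map_inj_in_uniq ?enum_uniq // => x y.
  by rewrite !mem_enum; apply: margins_entries_inj.
move=> _ /mapP[[u b] + ->]; rewrite mem_enum => ub.
rewrite in_fset_set; last exact: finite_dep_vectors.
rewrite inE; apply: margins_dep_vectors => //.
- by move=> t; apply: entries_gt1 ub.
- by move=> s t; apply: choices_coprime ub.
- by move=> i; apply: le_trans AH; rewrite ler_nat; apply: row_prod_le ub.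
- by move=> j; apply: le_trans AH; rewrite ler_nat; apply: col_prod_le ub.
Qed.

End Construction.

(** * Choice of the parameters and asymptotics in [H] *)

Local Open Scope classical_set_scope.
Local Open Scope ring_scope.

Lemma geometric_bracket (R : realType) (A G x : R) : 1 <= A -> 2 <= G -> A <= x ->
  exists w : nat, A * G ^+ w <= x < A * G ^+ w.+1.
Proof.
move=> A1 G2 Ax.
have ex : exists w, x < A * G ^+ w.+1.
  exists (Num.truncn x); apply: lt_le_trans (truncnS_gt x) _.
  apply: (@le_trans _ _ (G ^+ (Num.truncn x).+1)); last first.
    by rewrite ler_peMl // exprn_ge0; lra.
  apply: (@le_trans _ _ (2 ^+ (Num.truncn x).+1)).
    by rewrite -natrX ler_nat ltnW // ltn_expl.
  by rewrite lerXn2r // nnegrE; lra.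
(* The least such [w] works: the lower bound is minimality if [w > 0], and [A <= x] if [w = 0]. *)
case: (ex_minnP ex) => w xw wmin; exists w; rewrite xw andbT.
case: w wmin {xw} => [|w] wmin; first by rewrite expr0 mulr1.
by rewrite leNgt; apply/negP => /wmin; rewrite ltnn.
Qed.

Theorem theorem5p2 (R : realType) (n k : nat) :
  (1 < k)%N -> n = (2 * k)%N ->
  exists c : R, 0 < c /\
    exists H0 : R, forall H : R, H0 <= H ->
      c * H ^+ k * ln H ^+ ((k - 1) ^ 2) <= (num_dep_vectors n (n - 1) H)%:R.
Proof.
move=> k_gt1 ->; rewrite mul2n -addnn.
case: k k_gt1 => // p p_gt0.
pose k := p.+1; rewrite -/k (_ : (k - 1)%N = p); last by rewrite /k subn1.
(* The least values allowed by [z_large] and [w_large]. *)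
pose z := (8 * (k * k) ^ 2)%N; pose w0 := (16 * (k * k) ^ 2 * z`!)%N.
(* With [q = 2 k^2 w] one has [2^(k q) = G^w], so the margins are at most [A G^w]. *)
pose A : R := ((2 * z`!) ^ k)%:R; pose G : R := (2 ^ (2 * k ^ 3))%:R.
have A1 : 1 <= A by rewrite ler1n expn_gt0 muln_gt0 fact_gt0.
have G2 : 2 <= G by rewrite ler_nat -[X in (X <= _)%N]expn1 leq_exp2l // muln_gt0.
pose D := ln A + 2 * ln G.
have lnA : 0 <= ln A by rewrite ln_ge0.
have lnG : 0 < ln G by rewrite ln_gt0 //; lra.
have D0 : 0 < D by rewrite /D; lra.
have AG0 : 0 < A * G by rewrite mulr_gt0; lra.
(* From [H < A G^(w+1)] follow [H^k <= (A G)^k G^(k w)] and, as [w >= 1], [ln H <= D w]. The factor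
   2 is the loss in the coprimality count. *)
exists (2 * (A * G) ^+ k * D ^+ (p ^ 2))^-1; split.
  by rewrite invr_gt0 !mulr_gt0 ?exprn_gt0.
(* This threshold forces [w > w0]. *)
exists (A * G ^+ w0.+1) => H H0H.
have Gw m : 1 <= G ^+ m by rewrite exprn_ege1 //; lra.
have [w /andP[wH Hw]] : exists w : nat, A * G ^+ w <= H < A * G ^+ w.+1.
  apply: geometric_bracket => //; apply: le_trans H0H.
  by rewrite ler_peMr //; lra.
have w0w : (w0 < w)%N.
  have := le_lt_trans H0H Hw; rewrite ltr_pM2l; last by lra.
  by rewrite ltr_eXn2l ?ltnS //; lra.
have GE m : G ^+ (m * w) = (2 ^ (m * (k * (2 * k ^ 2 * w))))%:R.
  by rewrite /G -natrX -expnM; congr (2 ^ _)%:R; rewrite !expnS expn0; ring.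
have main : w%:R ^+ (p ^ 2) * G ^+ (k * w) <= 2 * (num_dep_vectors (k + k) (k + k - 1) H)%:R.
  rewrite GE -natrX -!natrM ler_nat.
  apply: (@num_dep_vectors_ge R p w z) => //; first exact: ltnW.
  by move: wH; rewrite -[w in G ^+ w]mul1n GE mul1n -natrM.
have H1 : 1 <= H by apply: le_trans wH; rewrite (le_trans A1) // ler_peMr //; lra.
have HkG : H ^+ k <= (A * G) ^+ k * G ^+ (k * w).
  rewrite mulnC exprM -exprMn lerXn2r ?nnegrE ?mulr_ge0 ?exprn_ge0 //; try lra.
  by rewrite -mulrA -exprS ltW.
have lnH : ln H <= D * w%:R.
  apply: (@le_trans _ _ (ln (A * G ^+ w.+1))).
    by rewrite ler_ln ?posrE ?(ltW Hw) ?mulr_gt0 ?exprn_gt0; lra.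
  rewrite lnM ?posrE ?exprn_gt0; try lra.
  rewrite lnXn; last by lra.
  have w1 : 1 <= w%:R :> R by rewrite ler1n; lia.
  rewrite -[ln G *+ _]mulr_natr -natr1 /D; nra.
rewrite -mulrA [X in X <= _]mulrC ler_pdivrMr; last by rewrite !mulr_gt0 ?exprn_gt0.
apply: (@le_trans _ _ (((A * G) ^+ k * G ^+ (k * w)) * (D * w%:R) ^+ (p ^ 2))).
  apply: ler_pM => //; first by rewrite exprn_ge0; lra.
    by rewrite exprn_ge0 // ln_ge0.
  by rewrite lerXn2r ?nnegrE ?ln_ge0 // mulr_ge0 // ltW.
have -> : (A * G) ^+ k * G ^+ (k * w) * (D * w%:R) ^+ (p ^ 2) =
    ((A * G) ^+ k * D ^+ (p ^ 2)) * (w%:R ^+ (p ^ 2) * G ^+ (k * w)).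
  rewrite [(D * _) ^+ _]exprMn.
  move: ((A * G) ^+ k) (G ^+ _) (D ^+ _) (w%:R ^+ _) => a1 a2 a3 a4; ring.
apply: le_trans (ler_wpM2l _ main) _; first by rewrite mulr_ge0 ?exprn_ge0 // ltW.
by move: ((A * G) ^+ k) (D ^+ _) => a1 a2; lra.
Qed.
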